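(* Assume that for every $\lambda\in\mathbb{R}^m$ the point $\bar z(\lambda)\in Z$ satisfies $$\min_{z\in Z}\langle \nabla\mathcal{L}_\rho(\bar z(\lambda),\lambda),\, z-\bar z(\lambda)\rangle \ge -\left(1+\sqrt{2L_{\mathrm p}}\,R_{\mathrm p}\right)\varepsilon_{\mathrm{in}} .$$ Let $\theta_0=1$, $\theta_{k+1}=\frac12\left(1+\sqrt{4\theta_k^2+1}\right)$, $S_k=\sum_{j=0}^k\theta_j$, $a_{k+1}=S_{k+1}^{-1}\theta_{k+1}$, and let $(\lambda_k)_{k\ge0}$, $(\mu_k)_{k\ge0}$ be generated from $\lambda_0\in\mathbb{R}^m$ by $$\mu_k=\lambda_k+L_{\mathrm d}^{-1}\nabla\bar d_\rho(\lambda_k),\qquad \lambda_{k+1}=(1-a_{k+1})\mu_k+a_{k+1}\Big[\lambda_0+L_{\mathrm d}^{-1}\sum_{i=0}^k\theta_i\nabla\bar d_\rho(\lambda_i)\Big].$$ Let $\bar z_j=\bar z(\lambda_j)$ and $\hat z_k=S_k^{-1}\sum_{j=0}^k\theta_j\bar z_j$. Then for every $k\ge0$ $$-\left[\|\lambda^*\|+\frac\rho2\,v(k,\varepsilon_{\mathrm{in}})\right]v(k,\varepsilon_{\mathrm{in}})\le f(\hat z_k)-f^*\le\frac{2L_{\mathrm d}\|\lambda_0\|^2}{(k+1)(k+2)}+\frac{4(k+3)}{3}\left(1+\sqrt{2L_{\mathrm p}}\,R_{\mathrm p}\right)\varepsilon_{\mathrm{in}},$$ where $$v(k,\varepsilon_{\mathrm{in}}):=\frac{8L_{\mathrm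 d}R_{\mathrm d}}{(k+1)(k+2)}+4\sqrt{\frac{2L_{\mathrm d}(k+3)\left(1+\sqrt{2L_{\mathrm p}}\,R_{\mathrm p}\right)\varepsilon_{\mathrm{in}}}{3(k+1)(k+2)}},\qquad R_{\mathrm d}=\|\lambda_0-\lambda^*\|.$$
   Context: Setting: $f:\mathbb{R}^n\to\mathbb{R}$ is convex and differentiable, $A\in\mathbb{R}^{m\times n}$ has full row rank, $b\in\mathbb{R}^m$, $Z\subset\mathbb{R}^n$ is nonempty, compact and convex, $\rho>0$, $\varepsilon_{\mathrm{in}}>0$; $\|\cdot\|$ and $\langle\cdot,\cdot\rangle$ are the Euclidean norm and inner product. Primal problem: $f^*=\min\{f(z): Az=b,\ z\in Z\}$. Augmented Lagrangian: $\mathcal{L}_\rho(z,\lambda)=f(z)+\langle\lambda,Az-b\rangle+\frac\rho2\|Az-b\|^2$; $\nabla\mathcal{L}_\rho$ denotes its gradient in $z$, assumed Lipschitz continuous in $z$ on $\mathbb{R}^n$ with constant $L_{\mathrm p}>0$ for each $\lambda$. $R_{\mathrm p}=\max_{z,y\in Z}\|z-y\|$. Augmented dual function: $d_\rho(\lambda)=\min_{z\in Z}\mathcal{L}_\rho(z,\lambda)$. Slater's constraint qualification is assumed, so that $f^*=\max_{\lambda}\min_{z\in Z}\{f(z)+\langle\lambda,Az-b\rangle\}$; $\lambda^*$ denotes a maximizer of this dual problem (the ordinary dual and the problem $\max_\lambda d_\rho(\lambda)$ have the same optimal value and the same optimal solutions). $L_{\mathrm d}=1/\rho$. Inexact dual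 information: for each $\lambda$ an approximate minimizer $\bar z(\lambda)\in Z$ of $\mathcal{L}_\rho(\cdot,\lambda)$ over $Z$ is fixed, and $\nabla\bar d_\rho(\lambda):=A\bar z(\lambda)-b$ (a notation, not necessarily a gradient). *)

(* Defs.v *)
From HB Require Import structures.
From mathcomp Require Import all_boot all_order all_algebra.
From mathcomp Require Import all_classical all_reals all_analysis.

Set Implicit Arguments.
Unset Strict Implicit.
Unset Printing Implicit Defensive.

Import Order.TTheory GRing.Theory Num.Theory.
Import numFieldNormedType.Exports.

Local Open Scope classical_set_scope.
Local Open Scope ring_scope.

(* The library norm `|x| on matrices is the sup norm, so the Euclidean
   structure on column vectors is defined here. *)
Definition dot (R : realType) (n : nat) (x y : 'cV[R]_n) : R :=
  \sum_(i < n) x i 0 * y i 0.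

Definition norm2 (R : realType) (n : nat) (x : 'cV[R]_n) : R :=
  Num.sqrt (dot x x).

Definition gradient (R : realType) (n : nat) (g : 'cV[R]_n -> R)
    (z : 'cV[R]_n) : 'cV[R]_n :=
  \col_(i < n) 'D_(delta_mx i 0) g z.

Definition is_min (R : realType) (T : Type) (S : set T) (g : T -> R) (v : R) :=
  (exists2 x, S x & g x = v) /\ (forall x, S x -> v <= g x).

Definition is_max (R : realType) (T : Type) (S : set T) (g : T -> R) (v : R) :=
  (exists2 x, S x & g x = v) /\ (forall x, S x -> g x <= v).

(* The attained minimum (maximum) of g over S; the value 0 is returned only
   when there is none. *)
Definition minval (R : realType) (T : Type) (S : set T) (g : T -> R) : R :=
  xget 0 [set v | is_min S g v].

Definition maxval (R : realType) (T : Type) (S : set T) (g : T -> R) : R :=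
  xget 0 [set v | is_max S g v].

Lemma minvalE (R : realType) (T : Type) (S : set T) (g : T -> R) (v : R) :
  is_min S g v -> minval S g = v.
Proof.
move=> [[x Sx gx] gv]; rewrite /minval; case: xgetP => [u -> [[y Sy gy] gu]|].
  by apply/le_anti; rewrite -{1}gx gu //= -gy gv.
by move/(_ v); case; split=> //; exists x.
Qed.

Lemma maxvalE (R : realType) (T : Type) (S : set T) (g : T -> R) (v : R) :
  is_max S g v -> maxval S g = v.
Proof.
move=> [[x Sx gx] gv]; rewrite /maxval; case: xgetP => [u -> [[y Sy gy] gu]|].
  by apply/le_anti; rewrite -{2}gx gu //= -gy gv.
by move/(_ v); case; split=> //; exists x.
Qed.

Definition affine_hull (R : realType) (n : nat) (Z : set 'cV[R]_n) :
    set 'cV[R]_n :=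
  [set x | exists (k : nat) (w : 'I_k -> R) (p : 'I_k -> 'cV[R]_n),
     [/\ forall i, Z (p i), \sum_(i < k) w i = 1
       & x = \sum_(i < k) w i *: p i]].

Definition relint (R : realType) (n : nat) (Z : set 'cV[R]_n) :
    set 'cV[R]_n :=
  [set x | Z x /\ exists2 e : R, 0 < e &
     forall y, affine_hull Z y -> norm2 (y - x) < e -> Z y].

Section Problem.
Context {R : realType} {m n : nat}.
Variables (f : 'cV[R]_n -> R) (A : 'M[R]_(m, n)) (b : 'cV[R]_m).
Variable Z : set 'cV[R]_n.

Definition feasible : set 'cV[R]_n := Z `&` [set z | A *m z = b].

Definition slater := exists2 z, relint Z z & A *m z = b.

Definition primal_value : R := minval feasible f.

Definition lagrangian (z : 'cV[R]_n) (lam : 'cV[R]_m) : R :=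
  f z + dot lam (A *m z - b).

Definition dual_function (lam : 'cV[R]_m) : R :=
  minval Z (fun z => lagrangian z lam).

Definition dual_solution (lam : 'cV[R]_m) :=
  forall mu, dual_function mu <= dual_function lam.

Definition aug_lagrangian (rho : R) (z : 'cV[R]_n) (lam : 'cV[R]_m) : R :=
  f z + dot lam (A *m z - b) + rho / 2 * norm2 (A *m z - b) ^+ 2.

Definition grad_aug_lagrangian (rho : R) (z : 'cV[R]_n) (lam : 'cV[R]_m) :
    'cV[R]_n :=
  gradient (fun y => aug_lagrangian rho y lam) z.

Definition diameter : R :=
  maxval (Z `*` Z) (fun p : 'cV[R]_n * 'cV[R]_n => norm2 (p.1 - p.2)).

Definition inexact_dual_grad (zbar : 'cV[R]_m -> 'cV[R]_n) (lam : 'cV[R]_m) :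
    'cV[R]_m :=
  A *m zbar lam - b.

End Problem.

Fixpoint theta {R : realType} (k : nat) : R :=
  if k is k'.+1 then 2^-1 * (1 + Num.sqrt (4 * theta k' ^+ 2 + 1)) else 1.

Definition theta_sum {R : realType} (k : nat) : R := \sum_(j < k.+1) theta j.

Definition theta_avg {R : realType} (n : nat) (z : nat -> 'cV[R]_n) (k : nat) :
    'cV[R]_n :=
  (theta_sum k)^-1 *: \sum_(j < k.+1) theta j *: z j.

(* The coefficient a_k = theta_k / S_k, used for k >= 1. *)
Definition step_weight {R : realType} (k : nat) : R :=
  (theta_sum k)^-1 * theta k.

Definition inner_accuracy {R : realType} (Lp Rp eps : R) : R :=
  (1 + Num.sqrt (2 * Lp) * Rp) * eps.

Definition infeasibility_bound {R : realType} (Ld Rd Lp Rp eps : R) (k : nat) :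
    R :=
  8 * Ld * Rd / (k.+1%:R * k.+2%:R)
  + 4 * Num.sqrt (2 * Ld * k.+3%:R * inner_accuracy Lp Rp eps
                  / (3 * k.+1%:R * k.+2%:R)).

(* Main.v *)
Require Import Defs.
From HB Require Import structures.
From mathcomp Require Import all_boot all_order all_algebra.
From mathcomp Require Import all_classical all_reals all_analysis.
From mathcomp Require Import ring lra.

Import Order.TTheory GRing.Theory Num.Theory.
Import numFieldNormedType.Exports.

Local Open Scope classical_set_scope.
Local Open Scope ring_scope.

(** By convexity of [f], a point [zbar lam] satisfying the inexact optimality
    condition for the augmented Lagrangian at [lam] minimizes, up to
    [d := inner_accuracy Lp Rp eps], the ordinary Lagrangian at
    [mu := lam + rho *: (A *m zbar lam - b)]. The iteration is thus an accelerated
    proximal-point method for the ordinary dual, with inexact supergradients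
    [g j := A *m zbar (lam j) - b] at [mu j]. Nesterov's estimate-sequence
    argument, together with [theta k ^+ 2 = S], [S := theta_sum k], gives with
    [w := A *m zhat - b]
      [f zhat - f_star + dot (lam 0) w + rho * S * norm2 w ^+ 2 / 2 <= d * k.+1].
    Completing the square yields the upper bound. Since
    [f_star <= f zhat + dot lam_star w], the same inequality bounds [norm2 w] by
    [v], and then the lower bound is Cauchy-Schwarz.
    Strong duality comes from one exact proximal step at [lam_star]: such a step
    strictly increases the dual function unless it lands on a feasible point. *)

(** * Euclidean inner product and the Cauchy-Schwarz inequality *)

Section Euclidean.
Context {R : realType} {n : nat}.
Implicit Types (x y z : 'cV[R]_n) (c : R).

Lemma dotC x y : dot x y = dot y x.
Proof. by apply: eq_bigr => i _; rewrite mulrC. Qed.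

Lemma dotDl x y z : dot (x + y) z = dot x z + dot y z.
Proof.
by rewrite /dot -big_split/=; apply: eq_bigr => i _; rewrite mxE mulrDl.
Qed.

Lemma dotZl c x y : dot (c *: x) y = c * dot x y.
Proof. by rewrite /dot mulr_sumr; apply: eq_bigr => i _; rewrite mxE mulrA. Qed.

Lemma dotDr x y z : dot x (y + z) = dot x y + dot x z.
Proof. by rewrite dotC dotDl !(dotC x). Qed.

Lemma dotZr c x y : dot x (c *: y) = c * dot x y.
Proof. by rewrite dotC dotZl dotC. Qed.

Lemma dotNl x y : dot (- x) y = - dot x y.
Proof. by rewrite -scaleN1r dotZl mulN1r. Qed.

Lemma dotNr x y : dot x (- y) = - dot x y.
Proof. by rewrite dotC dotNl dotC. Qed.

Definition dotE := (dotDl, dotDr, dotNl, dotNr, dotZl, dotZr).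

Lemma dot_ge0 x : 0 <= dot x x.
Proof. by apply: sumr_ge0 => i _; rewrite -expr2 sqr_ge0. Qed.

Lemma dot_eq0 x : dot x x = 0 -> x = 0.
Proof.
move=> /eqP; rewrite psumr_eq0 => [/allP x0|i _]; last by rewrite -expr2 sqr_ge0.
apply/colP => i; rewrite mxE; apply/eqP.
by have := x0 i (mem_index_enum _); rewrite -expr2 sqrf_eq0.
Qed.

Lemma norm2_ge0 x : 0 <= norm2 x.
Proof. exact: sqrtr_ge0. Qed.

Lemma norm2_sqr x : norm2 x ^+ 2 = dot x x.
Proof. by rewrite sqr_sqrtr// dot_ge0. Qed.

Lemma Cauchy_Schwarz x y : dot x y <= norm2 x * norm2 y.
Proof.
have [y0|y_neq0] := eqVneq (dot y y) 0.
  by rewrite (dot_eq0 _ y0) -(scale0r 0) dotZr mul0r mulr_ge0// norm2_ge0.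
have yy_gt0 : 0 < dot y y by rewrite lt_neqAle eq_sym y_neq0 dot_ge0.
have [xy_le0|xy_gt0] := leP (dot x y) 0.
  by rewrite (le_trans xy_le0)// mulr_ge0// norm2_ge0.
rewrite -(ler_pXn2r (n := 2)) ?nnegrE ?mulr_ge0 ?norm2_ge0//; last exact: ltW.
rewrite exprMn !norm2_sqr -subr_ge0 -(pmulr_rge0 _ yy_gt0).
(* This vector is [dot y y] times the component of [x] orthogonal to [y]. *)
have := dot_ge0 (dot y y *: x - dot x y *: y).
by rewrite !dotE (dotC y x); congr (_ <= _); ring.
Qed.

End Euclidean.

(** * Directional derivatives, convexity and attained minima *)

Section Gradient.
Context {R : realType} {n : nat}.
Implicit Types (z v : 'cV[R]_n).

Lemma dot_gradient (g : 'cV[R]_n -> R) z v : differentiable g z ->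
  dot (gradient g z) v = 'D_v g z.
Proof.
move=> dg; rewrite deriveE//.
have {2}-> : v = \sum_(i < n) v i 0 *: delta_mx i 0.
  by rewrite [LHS]matrix_sum_delta; apply: eq_bigr => i _; rewrite big_ord1.
rewrite linear_sum/=; apply: eq_bigr => i _.
by rewrite mxE deriveE// linearZ/= mulrC.
Qed.

(** The quotients at small [t > 0] are at most [c + t * C], which tends to [c]. The term [t * C]
    absorbs the quadratic penalty. *)
Lemma derive_le_of_quotient (g : 'cV[R]_n -> R) z v (c C : R) : differentiable g z ->
  (forall t, 0 < t -> t < 1 -> g (t *: v + z) - g z <= t * (c + t * C)) ->
  'D_v g z <= c.
Proof.
move=> dg gle.
have /cvg_dnbhs_at_right cl := @diff_derivable _ _ _ g z v dg.
apply: (@ler_cvg_to _ _ _ _ (fun h : R => h^-1 *: ((g \o shift z) (h *: v) - g z))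
  (fun t => c + t * C)) cl _ _.
- rewrite -[X in _ --> X]addr0 -[X in _ --> _ + X](mul0r C); apply: cvgD; first exact: cvg_cst.
  apply: cvgMr_tmp. exact: (@cvg_at_right_filter _ _ id _ _ cvg_id).
- near=> t.
  have t0 : 0 < t by near: t; exact: nbhs_right_gt.
  rewrite /= /GRing.scale/= ler_pdivrMl//; apply: (gle _ t0).
  by near: t; exact: nbhs_right_lt.
Unshelve. all: by end_near. Qed.

Lemma scale_subr_addr (t : R) y z :
  t *: (y - z) + z = t *: y + (1 - t) *: z.
Proof. by rewrite scalerBr scalerBl scale1r -addrA [- _ + z]addrC. Qed.

Lemma convex_functionP (f : 'cV[R]_n -> R) : convex_function [set: 'cV[R]_n] f ->
  forall t x y, 0 <= t -> t <= 1 ->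
  f (t *: x + (1 - t) *: y) <= t * f x + (1 - t) * f y.
Proof.
by move=> cf t x y t0 t1; have := cf (Itv01 t0 t1) x y; rewrite !inE; apply.
Qed.

Lemma convex_setP (Z : set 'cV[R]_n) : convex_set Z ->
  forall t x y, 0 <= t -> t <= 1 -> Z x -> Z y -> Z (t *: x + (1 - t) *: y).
Proof.
move=> cZ t x y t0 t1 Zx Zy; have := cZ x y (Itv01 t0 t1).
by rewrite !inE; apply.
Qed.

Lemma compact_argmin (Z : set 'cV[R]_n) (g : 'cV[R]_n -> R) :
  Z !=set0 -> compact Z -> (forall z, differentiable g z) ->
  exists2 z, Z z & forall y, Z y -> g z <= g y.
Proof.
move=> Z0 cZ dg.
have [|c] := compact_EVT_min (f := g) Z0 cZ.
  by apply: continuous_subspaceT => z; apply: differentiable_continuous.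
by rewrite inE => Zc gc; exists c => // y Zy; apply: gc; rewrite inE.
Qed.

Lemma minval_le (Z : set 'cV[R]_n) (g : 'cV[R]_n -> R) y :
  Z !=set0 -> compact Z -> (forall z, differentiable g z) -> Z y ->
  minval Z g <= g y.
Proof.
move=> Z0 cZ dg Zy; have [z Zz gz] := compact_argmin _ _ Z0 cZ dg.
by rewrite (minvalE (v := g z)) ?gz//; split => //; exists z.
Qed.

Lemma differentiable_dot m (u w : 'cV[R]_n -> 'cV[R]_m) z :
  (forall i, differentiable (fun y => u y i 0) z) ->
  (forall i, differentiable (fun y => w y i 0) z) ->
  differentiable (fun y => dot (u y) (w y)) z.
Proof.
move=> du dw.
rewrite (_ : (fun y => _) = \sum_(i < m) (fun y => u y i 0 * w y i 0)).
  by apply: differentiable_sum => i; apply: differentiableM.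
by apply/funext => y; rewrite fct_sumE.
Qed.

Lemma differentiable_affine m (A : 'M[R]_(m, n)) b i z :
  differentiable (fun y : 'cV[R]_n => (A *m y - b) i 0) z.
Proof.
rewrite (_ : (fun y => _) =
  (\sum_(j < n) (A i j *: (fun y : 'cV[R]_n => y j 0))) - cst (b i 0)).
  apply: differentiableB => //; apply: differentiable_sum => j.
  by apply: differentiableZ; exact: differentiable_coord.
apply/funext => y; rewrite !mxE; congr (_ - _).
by rewrite fct_sumE; apply: eq_bigr.
Qed.

Lemma differentiable_dotB (u a : 'cV[R]_n) z :
  differentiable (fun y => dot u (y - a)) z.
Proof.
apply: differentiable_dot => i //.
under eq_fun do rewrite -[X in X - _]mul1mx.
exact: differentiable_affine.
Qed.

End Gradient.

(** * The sequence [theta], its partial sums and weighted averages *)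

Section ThetaSequence.
Context {R : realType}.
Implicit Types k : nat.

Lemma theta0 : theta 0 = 1 :> R.
Proof. by []. Qed.

Lemma thetaS k :
  theta k.+1 = 2^-1 * (1 + Num.sqrt (4 * theta k ^+ 2 + 1)) :> R.
Proof. by []. Qed.

#[local] Arguments theta : simpl never.

(** By definition [theta k.+1] is the positive root of [x ^+ 2 - x - theta k ^+ 2]. *)
Lemma theta_recE k : theta k.+1 ^+ 2 = theta k.+1 + theta k ^+ 2 :> R.
Proof.
rewrite thetaS; set r := Num.sqrt _.
have rE : r ^+ 2 = 4 * theta k ^+ 2 + 1.
  by rewrite sqr_sqrtr// addr_ge0// mulr_ge0// sqr_ge0.
have -> : theta k ^+ 2 = (r ^+ 2 - 1) / 4 by rewrite rE; field.
by field.
Qed.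

Lemma theta_sumS k : theta_sum k.+1 = theta_sum k + theta k.+1 :> R.
Proof. exact: big_ord_recr. Qed.

Lemma theta_sum0 : theta_sum 0 = 1 :> R.
Proof. exact: big_ord1. Qed.

Lemma theta_sumE k : theta_sum k = theta k ^+ 2 :> R.
Proof.
elim: k => [|k IHk]; first by rewrite theta_sum0 theta0 expr1n.
by rewrite theta_sumS theta_recE IHk addrC.
Qed.

(** Each step adds at least [1 / 2], because the square root is at least [2 * theta k]. *)
Lemma theta_ge k : k.+2%:R / 2 <= theta k :> R.
Proof.
elim: k => [|k IHk]; first by rewrite theta0 mulfV.
have k_ge0 : 0 <= k.+2%:R :> R by [].
have : theta k + 2^-1 <= theta k.+1 :> R.
  rewrite thetaS; set r := Num.sqrt _.
  have r_ge0 : 0 <= r by exact: sqrtr_ge0.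
  have rE : r ^+ 2 = 4 * theta k ^+ 2 + 1.
    by rewrite sqr_sqrtr// addr_ge0// mulr_ge0// sqr_ge0.
  suff : 2 * theta k <= r by lra.
  rewrite -(ler_pXn2r (n := 2)) ?nnegrE//; last by lra.
  by rewrite rE exprMn; lra.
by rewrite -(natr1 k.+2); lra.
Qed.

Lemma theta_gt0 k : 0 < theta k :> R.
Proof. by apply: lt_le_trans (theta_ge k); rewrite divr_gt0. Qed.

Lemma theta_sum_gt0 k : 0 < theta_sum k :> R.
Proof. by rewrite theta_sumE exprn_gt0// theta_gt0. Qed.

Lemma theta_sum_ge k : k.+1%:R * k.+2%:R / 4 <= theta_sum k :> R.
Proof.
have kge0 : 0 <= k.+2%:R :> R by [].
have : (k.+2%:R / 2) ^+ 2 <= theta_sum k :> R.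
  rewrite theta_sumE ler_pXn2r ?nnegrE ?theta_ge ?divr_ge0//.
  exact/ltW/theta_gt0.
by apply: le_trans; rewrite -(natr1 k.+1); nra.
Qed.

Lemma theta_sum_le j k : (j <= k)%N -> theta_sum j <= theta_sum k :> R.
Proof.
move=> /subnK <-; elim: (k - j)%N => [|i IHi]; first by rewrite add0n.
by rewrite addSn theta_sumS (le_trans IHi)// lerDl ltW// theta_gt0.
Qed.

(** Controls the accumulated inner error: after division by [theta_sum k] it grows only linearly in
    [k]. *)
Lemma sum_theta_sum_le k :
  \sum_(j < k.+1) theta_sum j <= k.+1%:R * theta_sum k :> R.
Proof.
have : \sum_(j < k.+1) theta_sum j <= \sum_(j < k.+1) theta_sum k :> R.
  by apply: ler_sum => j _; apply: theta_sum_le; rewrite -ltnS.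
by rewrite sumr_const card_ord mulr_natl.
Qed.

Lemma step_weight_gt0 k : 0 < step_weight k :> R.
Proof. by rewrite mulr_gt0 ?invr_gt0 ?theta_sum_gt0 ?theta_gt0. Qed.

Lemma step_weight_le1 k : step_weight k <= 1 :> R.
Proof.
rewrite /step_weight ler_pdivrMl ?theta_sum_gt0// mulr1.
case: k => [|k]; first by rewrite theta_sum0.
by rewrite theta_sumS lerDr ltW// theta_sum_gt0.
Qed.

Lemma theta_sum_weight k : theta_sum k * step_weight k = theta k :> R.
Proof. by rewrite mulrA mulfV ?mul1r// gt_eqF// theta_sum_gt0. Qed.

Lemma theta_sum_avg n (z : nat -> 'cV[R]_n) k :
  theta_sum k *: theta_avg z k = \sum_(j < k.+1) theta j *: z j.
Proof. by rewrite scalerA mulfV ?scale1r// gt_eqF// theta_sum_gt0. Qed.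

Lemma theta_avg0 n (z : nat -> 'cV[R]_n) : theta_avg z 0 = z 0%N.
Proof. by rewrite /theta_avg theta_sum0 big_ord1 invr1 !scale1r. Qed.

(** As a two-point convex combination, the average inherits convexity statements by induction. *)
Lemma theta_avgS n (z : nat -> 'cV[R]_n) k :
  theta_avg z k.+1 =
  step_weight k.+1 *: z k.+1 + (1 - step_weight k.+1) *: theta_avg z k.
Proof.
have S0 j : theta_sum j != 0 :> R by rewrite gt_eqF// theta_sum_gt0.
apply: (scalerI (S0 k.+1)); rewrite theta_sum_avg scalerDr.
rewrite (scalerA _ (step_weight _)) (scalerA _ (1 - _)) mulrBr mulr1.
rewrite theta_sum_weight theta_sumS addrK theta_sum_avg big_ord_recr/=.
by rewrite addrC.
Qed.

Lemma convex_set_theta_avg n (Z : set 'cV[R]_n) (z : nat -> 'cV[R]_n) k :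
  convex_set Z -> (forall j, Z (z j)) -> Z (theta_avg z k).
Proof.
move=> cZ Zz; elim: k => [|k IHk]; first by rewrite theta_avg0.
by rewrite theta_avgS; apply: convex_setP; rewrite // ?step_weight_le1// ltW//
  step_weight_gt0.
Qed.

Lemma convex_function_theta_avg n (f : 'cV[R]_n -> R) (z : nat -> 'cV[R]_n) k :
  convex_function [set: 'cV[R]_n] f ->
  theta_sum k * f (theta_avg z k) <= \sum_(j < k.+1) theta j * f (z j).
Proof.
move=> cf; elim: k => [|k IHk].
  by rewrite theta_avg0 theta_sum0 big_ord1.
rewrite big_ord_recr/= theta_avgS.
have := @convex_functionP _ _ _ cf (step_weight k.+1) (z k.+1) (theta_avg z k)
  (ltW (step_weight_gt0 _)) (step_weight_le1 _).
rewrite -(ler_pM2l (theta_sum_gt0 k.+1)) => /le_trans; apply.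
rewrite mulrDr !(mulrA _ _ (f _)) mulrBr mulr1 theta_sum_weight.
by rewrite theta_sumS addrK [leLHS]addrC; exact: lerD.
Qed.

End ThetaSequence.

(** * Estimate-sequence induction for the accelerated method *)

Section AcceleratedEstimate.
#[local] Arguments theta : simpl never.
Context {R : realType} {m : nat}.
Variables (rho delta : R) (g lam mu : nat -> 'cV[R]_m) (F D : nat -> R).
Hypothesis rho_gt0 : 0 < rho.

Let s k := lam 0%N + rho *: \sum_(i < k.+1) theta i *: g i.

Hypothesis mu_rec : forall k, mu k = lam k + rho *: g k.
Hypothesis lam_rec : forall k,
  lam k.+1 = (1 - step_weight k.+1) *: mu k + step_weight k.+1 *: s k.
(** [F j + dot nu (g j)] plays the Lagrangian at [nu] of the [j]-th inexact minimizer, and [D k] a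
    lower estimate of the dual value at [mu k], tight up to [delta]. *)
Hypothesis D_le : forall k j, D k <= F j + dot (mu k) (g j).
Hypothesis D_ge : forall k, F k + dot (mu k) (g k) - delta <= D k.

(* The left-hand side is the maximum over [nu], attained at [s k], of the
   estimate function
   [\sum_j theta j * (F j + dot nu (g j)) - norm2 (nu - lam 0) ^+ 2 / (2 * rho)]
   of Nesterov's method. *)
Lemma accelerated_estimate k :
  \sum_(j < k.+1) theta j * F j
    + (dot (s k) (s k) - dot (lam 0%N) (lam 0%N)) / (2 * rho)
  <= theta_sum k * D k + delta * \sum_(j < k.+1) theta_sum j.
Proof.
have rho_neq0 : rho != 0 by rewrite gt_eqF.
elim: k => [|k IHk].
  (* Here [s 0] is [mu 0]: the square contributes [rho * G / 2], while [D_ge] supplies [rho * G]. *)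
  rewrite !big_ord1 theta_sum0 /= theta0 !mul1r mulr1.
  have := D_ge 0; have := dot_ge0 (g 0%N).
  rewrite /s mu_rec big_ord1 /= theta0 scale1r !dotE (dotC (g 0%N)) => g0 D0.
  set G := dot (g 0%N) _ in g0 D0 *; set P := dot (lam 0%N) (g 0%N) in D0 *.
  set Q := dot (lam 0%N) (lam 0%N).
  have -> : (Q + rho * P + (rho * P + rho * (rho * G)) - Q) / (2 * rho)
          = P + rho * G / 2 by field.
  have : 0 <= rho * G by rewrite mulr_ge0// ltW.
  lra.
have sS : s k.+1 = s k + (rho * theta k.+1) *: g k.+1.
  by rewrite /s big_ord_recr/= scalerDr addrA scalerA.
(* With these mixing weights, the bound [D_le] at [mu k] and the cross term from squaring [s k.+1]
   add up to the value at [lam k.+1]. *)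
have lamE : theta_sum k.+1 *: lam k.+1 = theta_sum k *: mu k + theta k.+1 *: s k.
  rewrite lam_rec scalerDr !scalerA mulrBr mulr1 theta_sum_weight.
  by rewrite theta_sumS addrK.
have dE : theta_sum k.+1 * dot (lam k.+1) (g k.+1) =
    theta_sum k * dot (mu k) (g k.+1) + theta k.+1 * dot (s k) (g k.+1).
  by rewrite -dotZl lamE !dotE.
clearbody s.
have DS := D_ge k.+1.
rewrite mu_rec !dotE -(ler_pM2l (theta_sum_gt0 k.+1)) in DS.
have DP := D_le k k.+1; rewrite -(ler_pM2l (theta_sum_gt0 k)) in DP.
rewrite [X in X + _]big_ord_recr [X in _ + delta * X]big_ord_recr.
rewrite sS !dotE (dotC (g k.+1)) /=.
have GG := dot_ge0 (g k.+1).
have S2 := @theta_sumE R k.+1.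
have Sp := @theta_sumS R k.
have S0 := @theta_sum_gt0 R k.+1.
move: IHk DS DP dE GG S2 Sp S0.
set G := dot (g k.+1) _; set P := dot (s k) (g k.+1); set Q := dot (lam 0%N) _.
set T := dot (s k) (s k); set M := dot (mu k) _; set N := dot (lam k.+1) _.
set th := theta k.+1; set S := theta_sum k; set S' := theta_sum k.+1.
set E := \sum_(_ < _) theta_sum _; set FF := \sum_(_ < _) _.
move=> IHk DS DP dE GG S2 Sp S0.
have -> : (T + rho * th * P + (rho * th * P + rho * th * (rho * th * G)) - Q)
   / (2 * rho) = (T - Q) / (2 * rho) + th * P + rho * (th ^+ 2 * G) / 2 by field.
(* Since [th ^+ 2 = S'], the quadratic term is half of the gain [S' * (rho * G)] from moving
   [lam k.+1] to [mu k.+1]. *)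
rewrite -S2.
have : 0 <= rho * (S' * G) by rewrite !mulr_ge0// ltW.
have -> : th = S' - S by rewrite Sp addrC addKr.
have Pe : (S' - S) * P = S' * N - S * M by rewrite dE Sp addrAC subrr add0r; ring.
rewrite Pe; move: IHk DS DP; rewrite !mulrDr mulrBl mulrN.
have -> : S' * (rho * G) = rho * (S' * G) by ring.
rewrite (mulrC S' delta).
lra.
Qed.

End AcceleratedEstimate.

(** * Augmented Lagrangian gradients and strong duality *)

Section Duality.
Context {R : realType} {m n : nat}.
Variables (f : 'cV[R]_n -> R) (A : 'M[R]_(m, n)) (b : 'cV[R]_m).
Variable Z : set 'cV[R]_n.
Hypothesis f_convex : convex_function [set: 'cV[R]_n] f.
Hypothesis f_diff : forall z : 'cV[R]_n, differentiable f z.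
Hypothesis Z_nonempty : Z !=set0.
Hypothesis Z_compact : compact Z.
Hypothesis Z_convex : convex_set Z.

Lemma differentiable_lagrangian lam z :
  differentiable (fun y => lagrangian f A b y lam) z.
Proof.
apply: differentiableD => //; apply: differentiable_dot => i //.
exact: differentiable_affine.
Qed.

Lemma differentiable_aug_lagrangian rho lam z :
  differentiable (fun y => aug_lagrangian f A b rho y lam) z.
Proof.
apply: differentiableD; first exact: differentiable_lagrangian.
under eq_fun do rewrite norm2_sqr.
by apply: differentiableZ; apply: differentiable_dot => i;
  exact: differentiable_affine.
Qed.

Lemma dual_function_le lam z : Z z ->
  dual_function f A b Z lam <= lagrangian f A b z lam.
Proof. by apply: minval_le => // y; exact: differentiable_lagrangian. Qed.

(* The gradient of the augmented Lagrangian at [lam] is the gradient of the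
   ordinary Lagrangian at the shifted multiplier [lam + rho *: (A *m z - b)]. *)
Lemma dot_grad_aug_lagrangian_le rho lam z y :
  dot (grad_aug_lagrangian f A b rho z lam) (y - z) <=
  lagrangian f A b y (lam + rho *: (A *m z - b))
    - lagrangian f A b z (lam + rho *: (A *m z - b)).
Proof.
rewrite dot_gradient; last exact: differentiable_aug_lagrangian.
(* The constant is the second-order term of the penalty along [y - z]; the multiplier and penalty
   terms expand exactly, so convexity of [f] is the only inequality. *)
apply: (@derive_le_of_quotient _ _ _ _ _ _ (rho / 2 * dot (A *m (y - z)) (A *m (y - z)))).
  exact: differentiable_aug_lagrangian.
move=> t t0 t1; rewrite /aug_lagrangian /lagrangian !norm2_sqr.
have ft := @convex_functionP _ _ _ f_convex t y z (ltW t0) (ltW t1).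
rewrite -scale_subr_addr in ft.
have -> : A *m (t *: (y - z) + z) - b = t *: (A *m (y - z)) + (A *m z - b).
  by rewrite mulmxDr -scalemxAr addrA.
have -> : A *m y - b = A *m (y - z) + (A *m z - b).
  by rewrite mulmxBr addrA subrK.
move: (A *m (y - z)) (A *m z - b) => u w.
rewrite !dotE (dotC u w) -subr_ge0.
rewrite -subr_ge0 in ft.
by move: ft; congr (_ <= _); field.
Qed.

(* With [z] minimizing the augmented Lagrangian at [lam], the multiplier
   [lam + rho *: (A *m z - b)] improves the dual value by at least
   [rho * norm2 (A *m z - b) ^+ 2]; at a dual solution this forces [A *m z = b]. *)
Lemma strong_duality lam : dual_solution f A b Z lam ->
  exists2 z, feasible A b Z z & forall y, Z y -> f z <= lagrangian f A b y lam.
Proof.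
move=> lam_opt.
have [z Zz zmin] := @compact_argmin _ _ _ _ Z_nonempty Z_compact
  (differentiable_aug_lagrangian 1 lam).
pose mu := lam + 1 *: (A *m z - b).
(* First-order optimality of [z] makes the derivative towards [y] nonnegative, and the gradient
   inequality transfers this to the ordinary Lagrangian at [mu]. *)
have mu_min y : Z y -> lagrangian f A b z mu <= lagrangian f A b y mu.
  move=> Zy; rewrite -subr_ge0.
  apply: le_trans (dot_grad_aug_lagrangian_le _ _ _ _).
  rewrite dot_gradient; last exact: differentiable_aug_lagrangian.
  have /cvg_dnbhs_at_right cl := @diff_derivable _ _ _ _ z (y - z)
    (differentiable_aug_lagrangian 1 lam z).
  apply: (@ler_cvg_to _ _ _ _ (cst 0) _ _ _ (cvg_cst _) cl).
  near=> t.
  have t0 : 0 < t by near: t; exact: nbhs_right_gt.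
  have t1 : t < 1 by near: t; exact: nbhs_right_lt.
  rewrite mulr_ge0 ?invr_ge0 ?(ltW t0)// subr_ge0 /=; apply: zmin.
  by rewrite scale_subr_addr; apply: convex_setP => //; exact: ltW.
have dmu : dual_function f A b Z mu = lagrangian f A b z mu.
  by apply: minvalE; split => //; exists z.
have := lam_opt mu; rewrite dmu => /le_trans/(_ (dual_function_le lam _ Zz)).
rewrite /lagrangian /mu scale1r dotDl lerD2l gerDl => w_le0.
have w0 : A *m z - b = 0.
  by apply: dot_eq0; apply/le_anti; rewrite w_le0 dot_ge0.
exists z => [|y Zy]; first by split => //; apply/subr0_eq.
have := mu_min y Zy; rewrite /mu w0 scaler0 addr0 {1}/lagrangian w0.
by rewrite -(scale0r 0) dotZr mul0r addr0.
Unshelve. all: by end_near. Qed.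

Lemma primal_valueE lam z : feasible A b Z z ->
  (forall y, Z y -> f z <= lagrangian f A b y lam) -> primal_value f A b Z = f z.
Proof.
move=> zF zle; apply: minvalE; split; first by exists z.
move=> y [Zy Ay]; apply: (le_trans (zle y Zy)).
by rewrite /lagrangian Ay subrr -(scale0r 0) dotZr mul0r addr0.
Qed.

End Duality.

(** * Signs of the constants and resolution of the quadratic inequality for the infeasibility *)

Lemma diameter_ge0 (R : realType) n (Z : set 'cV[R]_n) : 0 <= diameter Z.
Proof.
(* If no maximum is attained, the default value [0] is nonnegative too. *)
by rewrite /diameter /maxval; case: xgetP => // v _ [[p _ <-] _]; exact: norm2_ge0.
Qed.

Lemma inner_accuracy_ge0 (R : realType) (Lp Rp eps : R) :
  0 <= Rp -> 0 <= eps -> 0 <= inner_accuracy Lp Rp eps.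
Proof. by move=> Rp0 e0; rewrite mulr_ge0// addr_ge0// mulr_ge0// sqrtr_ge0. Qed.

(** Otherwise [x * x > p * x + q * x], while [q * x >= q ^+ 2]. *)
Lemma le_sum_of_quadratic (R : realType) (x p q : R) :
  0 <= p -> 0 <= q -> x ^+ 2 <= p * x + q ^+ 2 -> x <= p + q.
Proof. by move=> p0 q0 xle; rewrite leNgt; apply/negP => ltx; nra. Qed.

Lemma le_infeasibility_bound (R : realType) (rho Rd Lp Rp eps x : R) k :
  0 < rho -> 0 <= Rd -> 0 <= inner_accuracy Lp Rp eps ->
  rho * (k.+1%:R * k.+2%:R / 4) * x ^+ 2 / 2
    <= inner_accuracy Lp Rp eps * k.+1%:R + Rd * x ->
  x <= infeasibility_bound (1 / rho) Rd Lp Rp eps k.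
Proof.
move=> rho_gt0 Rd_ge0; rewrite /infeasibility_bound.
move: (inner_accuracy _ _ _) => d d_ge0.
have k1 : 0 < k.+1%:R :> R by [].
have k2 : 0 < k.+2%:R :> R by [].
have -> : k.+3%:R = k.+1%:R + 2 :> R by rewrite -natrD addn2.
move: k.+1%:R k.+2%:R k1 k2 => K1 K2 k1 k2 xle.
have rho_neq0 : rho != 0 by rewrite gt_eqF.
have K1_neq0 : K1 != 0 by rewrite gt_eqF.
have K2_neq0 : K2 != 0 by rewrite gt_eqF.
have r_ge0 : 0 <= rho^-1 by rewrite invr_ge0 ltW.
have K_ge0 : 0 <= K1 * K2 by rewrite mulr_ge0// ltW.
rewrite div1r; apply: le_sum_of_quadratic; first by rewrite divr_ge0// !mulr_ge0.
  by rewrite mulr_ge0// sqrtr_ge0.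
rewrite exprMn sqr_sqrtr; last first.
  by rewrite divr_ge0 ?mulr_ge0 ?addr_ge0 ?(ltW k1) ?(ltW k2).
have c_gt0 : 0 < rho * K1 * K2 / 8 by rewrite divr_gt0// !mulr_gt0.
rewrite -(ler_pM2l c_gt0).
(* After scaling, the squared root term is [4 * (K1 + 2) * d / 3], which exceeds the required
   [d * K1] by [(d * K1 + 8 * d) / 3]. *)
have -> : rho * K1 * K2 / 8 * (8 * rho^-1 * Rd / (K1 * K2) * x +
    4 ^+ 2 * (2 * rho^-1 * (K1 + 2) * d / (3 * K1 * K2))) =
    Rd * x + d * K1 + (d * K1 + 8 * d) / 3.
  by field; rewrite K1_neq0 K2_neq0 rho_neq0.
have -> : rho * K1 * K2 / 8 * x ^+ 2 = rho * (K1 * K2 / 4) * x ^+ 2 / 2 by field.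
have : 0 <= d * K1 by rewrite mulr_ge0// ltW.
lra.
Qed.

(** * Suboptimality bounds for the averaged primal iterate *)

Theorem theorem3p8 (R : realType) (m n : nat)
    (f : 'cV[R]_n -> R) (A : 'M[R]_(m, n)) (b : 'cV[R]_m) (Z : set 'cV[R]_n)
    (rho eps_in Lp : R)
    (f_convex : convex_function [set: 'cV[R]_n] f)
    (f_diff : forall z : 'cV[R]_n, differentiable f z)
    (A_full_row_rank : row_free A)
    (Z_nonempty : Z !=set0) (Z_compact : compact Z) (Z_convex : convex_set Z)
    (rho_gt0 : 0 < rho) (eps_in_gt0 : 0 < eps_in) (Lp_gt0 : 0 < Lp)
    (grad_lipschitz : forall (lam : 'cV[R]_m) (z y : 'cV[R]_n),
       norm2 (grad_aug_lagrangian f A b rho z lam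
              - grad_aug_lagrangian f A b rho y lam) <= Lp * norm2 (z - y))
    (slater_cq : slater A b Z)
    (lam_star : 'cV[R]_m) (lam_star_opt : dual_solution f A b Z lam_star)
    (zbar : 'cV[R]_m -> 'cV[R]_n)
    (zbar_in : forall lam : 'cV[R]_m, Z (zbar lam))
    (zbar_approx : forall lam : 'cV[R]_m,
       - inner_accuracy Lp (diameter Z) eps_in
       <= minval Z (fun z => dot (grad_aug_lagrangian f A b rho (zbar lam) lam)
                                 (z - zbar lam)))
    (Ld : R) (Ld_def : Ld = 1 / rho)
    (lam mu : nat -> 'cV[R]_m)
    (mu_rec : forall k : nat,
       mu k = lam k + Ld^-1 *: inexact_dual_grad A b zbar (lam k))
    (lam_rec : forall k : nat,
       lam k.+1 = (1 - step_weight k.+1) *: mu k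
         + step_weight k.+1 *:
           (lam 0%N
            + Ld^-1 *: \sum_(i < k.+1)
                theta i *: inexact_dual_grad A b zbar (lam i)))
    (k : nat) :
  let f_star := primal_value f A b Z in
  let Rp := diameter Z in
  let Rd := norm2 (lam 0%N - lam_star) in
  let v := infeasibility_bound Ld Rd Lp Rp eps_in k in
  let zhat := theta_avg (fun j => zbar (lam j)) k in
  - (norm2 lam_star + rho / 2 * v) * v <= f zhat - f_star
  /\ f zhat - f_star <=
       2 * Ld * norm2 (lam 0%N) ^+ 2 / (k.+1%:R * k.+2%:R)
       + 4 * k.+3%:R / 3 * inner_accuracy Lp Rp eps_in.
Proof.
move=> f_star Rp Rd v zhat.
set d := inner_accuracy Lp Rp eps_in.
have d_ge0 : 0 <= d by rewrite inner_accuracy_ge0 ?diameter_ge0// ltW.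
have rho_neq0 : rho != 0 by rewrite gt_eqF.
have LdV : Ld^-1 = rho by rewrite Ld_def invf_div divr1.
pose g j := inexact_dual_grad A b zbar (lam j).
pose F j := f (zbar (lam j)).
(* With this choice [D_ge] is an equality, and approximate optimality makes [D j] a lower bound of
   the Lagrangian at [mu j] over [Z]. *)
pose D j := F j + dot (mu j) (g j) - d.
have D_le j y : Z y -> D j <= lagrangian f A b y (mu j).
  move=> Zy.
  have := zbar_approx (lam j); rewrite -/Rp -/d => approx.
  have := @minval_le _ _ _ _ _ Z_nonempty Z_compact (@differentiable_dotB _ _
    (grad_aug_lagrangian f A b rho (zbar (lam j)) (lam j)) (zbar (lam j))) Zy.
  have := @dot_grad_aug_lagrangian_le _ _ _ f A b f_convex f_diff rho
    (lam j) (zbar (lam j)) y.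
  rewrite -[in X in _ <= X -> _]LdV -/(inexact_dual_grad A b zbar (lam j)) -mu_rec.
  by rewrite /D /lagrangian -/(g j) -/(F j) => *; lra.
have [zs zsF zs_le] := strong_duality _ _ _ _ f_convex f_diff Z_nonempty
  Z_compact Z_convex _ lam_star_opt.
have f_starE : f_star = f zs by exact: primal_valueE zsF zs_le.
have D_le_star j : D j <= f_star.
  have [Zzs Azs] := zsF; have := D_le j zs Zzs.
  by rewrite f_starE /lagrangian Azs subrr -(scale0r 0) dotZr mul0r addr0.
have S_gt0 := @theta_sum_gt0 R k.
set S := theta_sum k in S_gt0.
pose w := A *m zhat - b.
have wE : S *: w = \sum_(j < k.+1) theta j *: g j.
  rewrite scalerBr scalemxAr theta_sum_avg mulmx_sumr.
  rewrite scaler_suml -sumrB; apply: eq_bigr => j _.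
  by rewrite [RHS]scalerBr scalemxAr.
have zhat_lagr : f_star <= f zhat + dot lam_star w.
  by rewrite f_starE; apply: zs_le; exact: convex_set_theta_avg.
clearbody w.
(* In the accelerated estimate [s k] is [lam 0%N + (rho * S) *: w]; its square is expanded and a
   common factor [S] cancelled. *)
have est : f zhat - f_star + dot (lam 0%N) w + rho * S * dot w w / 2
    <= d * k.+1%:R.
  have := @accelerated_estimate R m rho d g lam mu F D rho_gt0.
  rewrite /= -LdV => /(_ mu_rec lam_rec (fun i j => D_le i _ (zbar_in (lam j)))).
  move=> /(_ (fun=> lexx _) k); rewrite LdV -wE.
  have := @convex_function_theta_avg _ _ f (fun j => zbar (lam j)) k f_convex.
  have := ler_wpM2l d_ge0 (@sum_theta_sum_le R k).
  have := ler_wpM2l (ltW S_gt0) (D_le_star k).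
  rewrite -/S -/zhat !dotE (dotC w (lam 0%N)) => DS dS fS.
  set P := dot (lam 0%N) w; set W := dot w w; set Q := dot (lam 0%N) _.
  have -> : (Q + rho * (S * P) + (rho * (S * P) + rho * (S * (rho * (S * W)))) - Q)
    / (2 * rho) = S * (P + rho * S * W / 2) by field.
  move=> est; rewrite -(ler_pM2l S_gt0).
  move: est fS dS DS; rewrite /F; lra.
have S_ge := @theta_sum_ge R k; rewrite -/S in S_ge.
have K_gt0 : 0 < k.+1%:R * k.+2%:R :> R by rewrite mulr_gt0.
(* Eliminating [f zhat] between [est] and [zhat_lagr] leaves [dot (lam_star - lam 0%N) w], hence the
   factor [Rd]. *)
have w_le : norm2 w <= v.
  rewrite /v Ld_def; apply: le_infeasibility_bound => //; first exact: norm2_ge0.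
  rewrite norm2_sqr -/d.
  have CS := @Cauchy_Schwarz R m (lam_star - lam 0%N) w.
  have RdE : norm2 (lam_star - lam 0%N) = Rd.
    by rewrite /Rd /norm2 -opprB dotNl dotNr opprK.
  rewrite RdE !dotE in CS.
  have : rho * (k.+1%:R * k.+2%:R / 4) * dot w w <= rho * S * dot w w.
    by rewrite ler_wpM2r ?dot_ge0// ler_wpM2l// ltW.
  move: est zhat_lagr CS; lra.
have v_ge0 : 0 <= v := le_trans (norm2_ge0 w) w_le.
split.
  have CS := @Cauchy_Schwarz R m lam_star w.
  have := ler_wpM2l (norm2_ge0 lam_star) w_le.
  (* Subtracting this nonnegative term from [- norm2 lam_star * v] keeps a lower bound. *)
  have : 0 <= rho / 2 * v * v by rewrite !mulr_ge0// ltW// divr_gt0.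
  rewrite mulNr mulrDl.
  move: zhat_lagr CS; lra.
(* The factor [2] is [4 / 2], from [S >= K / 4] with [K] the product of [k.+1] and [k.+2]. *)
have : dot (lam 0%N) (lam 0%N) / (2 * rho * S) <=
    2 * Ld * norm2 (lam 0%N) ^+ 2 / (k.+1%:R * k.+2%:R).
  move: (k.+1%:R * k.+2%:R) K_gt0 S_ge => K K_gt0 S_ge.
  have -> : dot (lam 0%N) (lam 0%N) / (2 * rho * S) =
      Ld * norm2 (lam 0%N) ^+ 2 / 2 * S^-1.
    by rewrite norm2_sqr Ld_def; field; rewrite rho_neq0 gt_eqF.
  have -> : 2 * Ld * norm2 (lam 0%N) ^+ 2 / K =
      Ld * norm2 (lam 0%N) ^+ 2 / 2 * (K / 4)^-1.
    by field; rewrite gt_eqF.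
  apply: ler_wpM2l.
    rewrite divr_ge0// mulr_ge0 ?sqr_ge0//.
    by rewrite Ld_def div1r invr_ge0 ltW.
  by rewrite lef_pV2// posrE divr_gt0.
(* Completed square: the sum is the squared norm of [lam 0%N + (rho * S) *: w] over
   [2 * rho * S]. *)
have : 0 <= dot (lam 0%N) (lam 0%N) / (2 * rho * S) + dot (lam 0%N) w
    + rho * S * dot w w / 2.
  have := dot_ge0 (lam 0%N + (rho * S) *: w).
  rewrite !dotE (dotC w (lam 0%N)).
  set P := dot (lam 0%N) w; set W := dot w w; set Q := dot (lam 0%N) _ => sq.
  have -> : Q / (2 * rho * S) + P + rho * S * W / 2 =
      (Q + rho * S * P + (rho * S * P + rho * S * (rho * S * W))) / (2 * rho * S).
    by field; rewrite rho_neq0 gt_eqF.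
  by rewrite divr_ge0// ltW// !mulr_gt0.
have : d * k.+1%:R <= 4 * k.+3%:R / 3 * d.
  rewrite mulrC ler_wpM2r//.
  have -> : k.+3%:R = k.+1%:R + 2 :> R by rewrite -natrD addn2.
  by have := ler0n R k.+1; lra.
move: est; move: (dot (lam 0%N) (lam 0%N) / _) (2 * Ld * _ / _).
move: (4 * _ / 3 * d) (d * _) => *; lra.
Qed.
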